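(* Let $n\ge 4$ and let $1\le j<n-2$. Let $\sigma_1,\dots,\sigma_j$ be pairwise distinct critical $1$-cells of $(C\Omega_n,W)$, $\sigma_i=(\emptyset,\emptyset,\emptyset,\emptyset,v_i,\emptyset,Z_i,w_i)$ for $1\le i\le j$. Then in $H^*(C\Omega_n;\mathbb{Z}_2)$ the cup product of the cohomology classes of the duals of $\sigma_1,\dots,\sigma_j$ is the cohomology class of the dual of the critical $j$-cell $(\emptyset,\emptyset,\emptyset,\emptyset,a,\emptyset,C',D)$, where $D=\{w_1,\dots,w_j\}$, $a=\max(\{1,\dots,n\}\setminus D)$ and $C'=\{1,\dots,n\}\setminus(D\cup\{a\})$.
   Context: Coefficients are in $\mathbb{Z}_2$. One-element sets $\{v\}$ are written $v$. The complex $C\Omega_n$ ($n\ge3$): a cell is a tuple $\sigma=(x_1,y_1,x_2,y_2,x_3,y_3,x_4,y_4)$ of pairwise disjoint subsets of $\{1,\dots,n\}$ with union $\{1,\dots,n\}$ and $x_3\ne\emptyset\ne x_4$; its dimension is $\sum_i|y_i|$. We write $x_i(\sigma),y_i(\sigma)$ for the entries. The boundary is the sum, over all $i$ and all $v\in y_i$, of the cell obtained by moving $v$ from $y_i$ to $x_i$ plus the cell obtained by moving $v$ from $y_i$ to $x_{i+1}$ (indices mod 4). (Geometrically: $n$ labelled points on the cycle graph $C_4$ with vertices $1,2,3,4$; $x_i$ are the points located at vertex $i$ and $y_i$ those on the edge from $i$ to $i+1$; vertices 3 and 4 must be occupied. So $C\Omega_n$ is a regular cubical complex structure on the space of tuples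 in $(S^1)^n$ whose entries include two fixed points.) The matching $W$ on the cells of $C\Omega_n$ consists of pairs $(\nu,W(\nu))$ with $\nu$ a codimension-one face of $W(\nu)$. Put $\alpha_i(\nu)=\min(x_i(\nu)\cup y_i(\nu))$ for $i=1,2,3$ and $\beta(\nu)=\max(y_3(\nu)\cup x_4(\nu))$. (1) If $x_1(\nu)\cup y_1(\nu)\neq\emptyset$: $\nu$ with $\alpha_1(\nu)\in x_1(\nu)$ is paired with the cell $W(\nu)$ obtained by moving $\alpha_1(\nu)$ from $x_1$ to $y_1$. (2) If $x_1=y_1=\emptyset$ and $x_2\cup y_2\ne\emptyset$: the same rule with $\alpha_2$, moving from $x_2$ to $y_2$. (3) If $x_1=y_1=x_2=y_2=\emptyset$ (Kozlov's matching $\mathcal M$): (3a) if $\alpha_3(\nu)\in x_3(\nu)$ and $|x_3(\nu)|\ge2$, $\nu$ is paired with the cell $W(\nu)$ obtained by moving $\alpha_3(\nu)$ from $x_3$ to $y_3$; (3b) if $x_3(\nu)=\{\alpha_3(\nu)\}$, $\beta(\nu)\in x_4(\nu)$, $|x_4(\nu)|\ge 2$ and $\beta(\nu)>\alpha_3(\nu)$, $\nu$ is paired with the cell $W(\nu)$ obtained by moving $\beta(\nu)$ from $x_4$ to $y_3$. Cells in no pair are critical. They are the cells with $x_1=y_1=x_2=y_2=\emptyset$, $x_3=\{\alpha_3\}$ and one of: $y_3=\emptyset$, $|x_4|\ge2$, $\beta<\alpha_3$; or $y_3=\emptyset$, $x_4=\{\beta\}$; or $y_3\neq\emptyset$, $x_4=\{\beta\}$,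 $\alpha_3<v<\beta$ for all $v\in y_3$. Cohomology classes: an upper $W$-path from a $k$-cell $\tau$ to a $k$-cell $\sigma$ is a sequence $\tau=\tau_1,\dots,\tau_q=\sigma$ ($q\ge1$) of $k$-cells with $\tau_i\ne\tau_{i+1}$, each $\tau_i$ ($i<q$) being the lower member of a pair of $W$ and $\tau_{i+1}$ a face of $W(\tau_i)$. For a critical $k$-cell $\sigma$, ''the cohomology class of the dual of $\sigma$'' is the class in $H^k(C\Omega_n;\mathbb{Z}_2)$ of the cubical cocycle $\sum_\tau N(\tau,\sigma)\,\tau^*$, where $\tau$ runs over all $k$-cells, $\tau^*$ is the dual cochain and $N(\tau,\sigma)$ is the number mod 2 of upper $W$-paths from $\tau$ to $\sigma$ (this is the image of $\sigma$ under the isomorphism from Morse cohomology to cubical cohomology; the Morse differential vanishes, so these classes form a basis). *)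

(* Defs.v *)
From HB Require Import structures.
From mathcomp Require Import all_boot all_order all_algebra.
From mathcomp Require Import zify.

Set Implicit Arguments.
Unset Strict Implicit.
Unset Printing Implicit Defensive.

Import GRing.Theory.
Local Open Scope ring_scope.
Local Open Scope quotient_scope.

(* Locations on the cycle graph C_4: [inl i] is the vertex i and [inr i] the
   edge from i to i + 1 (mod 4). Vertices are named v1, v2, v3, v4 below. *)
Definition loc : finType := ('I_4 + 'I_4)%type.

Definition v1 : 'I_4 := @Ordinal 4 0 isT.
Definition v2 : 'I_4 := @Ordinal 4 1 isT.
Definition v3 : 'I_4 := @Ordinal 4 2 isT.
Definition v4 : 'I_4 := @Ordinal 4 3 isT.

Definition vtx (i : 'I_4) : loc := inl i.
Definition edge (i : 'I_4) : loc := inr i.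

Definition is_edge (l : loc) : bool := if l is inr _ then true else false.

Definition endpoint (b : bool) (l : loc) : loc :=
  match l with
  | inl i => inl i
  | inr i => inl (if b then ordS i else i)
  end.

Section Complex.
Variable n : nat.

(* A partition of the label set into the eight (possibly empty) blocks
   x_1, y_1, ..., x_4, y_4 is the map sending a label to its location. The
   labels 1, ..., n are represented by 'I_n = {0, ..., n - 1}, in order. *)
Local Notation config := {ffun 'I_n -> loc}.

Definition occupied (c : config) : bool :=
  [exists u, c u == vtx v3] && [exists u, c u == vtx v4].

Record cell : Type := Cell {cell_config :> config; _ : occupied cell_config}.
HB.instance Definition _ := [isSub for cell_config].
HB.instance Definition _ := [Finite of cell by <:].

Definition xset (i : 'I_4) (s : cell) : {set 'I_n} := [set u | s u == vtx i].
Definition yset (i : 'I_4) (s : cell) : {set 'I_n} := [set u | s u == edge i].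

Definition entries (s : cell) :=
  (xset v1 s, yset v1 s, xset v2 s, yset v2 s,
   xset v3 s, yset v3 s, xset v4 s, yset v4 s).

Definition ysets (s : cell) : {set 'I_n} := [set u | is_edge (s u)].
Definition cell_dim (s : cell) : nat := #|ysets s|.

(* [push b S s] moves every label of S lying on an edge to the starting point
   (b = false) or to the end point (b = true) of that edge. *)
Definition push_config (b : bool) (S : {set 'I_n}) (c : config) : config :=
  [ffun u => if u \in S then endpoint b (c u) else c u].

Lemma push_occupied b S (s : cell) : occupied (push_config b S s).
Proof.
case: s => c /= /andP[/existsP[p /eqP Hp] /existsP[q /eqP Hq]].
apply/andP; split; apply/existsP; [exists p | exists q];
  by rewrite ffunE (Hp, Hq) /=; case: ifP.
Qed.

Definition push (b : bool) (S : {set 'I_n}) (s : cell) : cell :=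
  Cell (push_occupied b S s).

Definition face (t s : cell) : bool :=
  [exists u in ysets s,
     (t == push false [set u] s) || (t == push true [set u] s)].

Lemma pushE b S (s : cell) u :
  push b S s u = if u \in S then endpoint b (s u) else s u.
Proof. by rewrite /= ffunE. Qed.

Lemma cell_eqP (s t : cell) : s =1 t -> s = t.
Proof. by move=> H; apply/val_inj/ffunP. Qed.

Lemma ysets_push b S s : ysets (push b S s) = ysets s :\: S.
Proof.
apply/setP=> u; rewrite !inE pushE; case: (u \in S) => //=.
by case: (s u).
Qed.

Lemma endpointK b b' l : endpoint b (endpoint b' l) = endpoint b' l.
Proof. by case: l. Qed.

Lemma endpoint_edge b l : ~~ is_edge l -> endpoint b l = l.
Proof. by case: l. Qed.

Lemma push_comm b b' (S T : {set 'I_n}) s :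
  [disjoint S & T] -> push b S (push b' T s) = push b' T (push b S s).
Proof.
move=> /pred0P D; apply: cell_eqP => u; rewrite !pushE.
by have /= := D u; case: (u \in S); case: (u \in T).
Qed.

Lemma push_setI b (S S' : {set 'I_n}) s :
  (forall u, u \in ysets s -> (u \in S) = (u \in S')) -> push b S s = push b S' s.
Proof.
move=> HS; apply: cell_eqP => u; rewrite !pushE.
case: (boolP (is_edge (s u))) => [He|/endpoint_edge He].
  by rewrite HS ?inE.
by rewrite He; do 2?case: (_ \in _).
Qed.

Lemma push_pushU b S T s : push b S (push b T s) = push b (S :|: T) s.
Proof.
apply: cell_eqP => u; rewrite !pushE inE.
by case: (u \in S); case: (u \in T) => //=; rewrite endpointK.
Qed.

(* Cochains of all degrees together: C^k consists of those supported on the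
   cells of dimension k. Over 'F_2 a cochain is a function on the cells. *)
Definition cochain : Type := {ffun cell -> 'F_2}.
Identity Coercion ffun_of_cochain : cochain >-> finfun_of.
HB.instance Definition _ := Finite.on cochain.
HB.instance Definition _ := GRing.Zmodule.on cochain.

Implicit Types f g h : cochain.

Definition delta f : cochain :=
  [ffun s : cell => \sum_(u in ysets s)
     (f (push false [set u] s) + f (push true [set u] s))].

(* Serre's cup product on a product of directed graphs; for f of degree p only
   the S of size p contribute. *)
Definition cup f g : cochain :=
  [ffun s : cell => \sum_(S : {set 'I_n} | S \subset ysets s)
     f (push false (ysets s :\: S) s) * g (push true S s)].

Definition cochain1 : cochain := [ffun s : cell => (ysets s == set0)%:R].

Lemma F2_addxx (x : 'F_2) : x + x = 0.
Proof. by rewrite -mulr2n -mulr_natl (pchar_Fp_0 (isT : prime 2)) mul0r. Qed.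

Lemma cup1c : left_id cochain1 cup.
Proof.
move=> f; apply/ffunP=> s; rewrite ffunE (bigD1 set0) ?sub0set //= big1 => [|S].
  rewrite addr0 ffunE ysets_push setD0 setDv eqxx mul1r; congr (f _).
  by apply: cell_eqP => u; rewrite pushE inE.
case/andP=> sS nS; rewrite ffunE ysets_push.
by rewrite setDDr setDv set0U (setIidPr sS) (negPf nS) mul0r.
Qed.

Lemma cupc1 : right_id cochain1 cup.
Proof.
move=> f; apply/ffunP=> s; rewrite ffunE (bigD1 (ysets s)) //= big1 => [|S].
  rewrite addr0 ffunE ysets_push setDv eqxx mulr1; congr (f _).
  by apply: cell_eqP => u; rewrite pushE inE.
case/andP=> sS nS; rewrite [cochain1 _]ffunE ysets_push setD_eq0.
by rewrite eqEsubset sS /= in nS; rewrite (negPf nS) mulr0.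
Qed.

Lemma cupDl : left_distributive cup +%R.
Proof.
move=> f g h; apply/ffunP=> s; rewrite !ffunE -big_split /=.
by apply: eq_bigr => S _; rewrite ffunE mulrDl.
Qed.

Lemma cupDr : right_distributive cup +%R.
Proof.
move=> f g h; apply/ffunP=> s; rewrite !ffunE -big_split /=.
by apply: eq_bigr => S _; rewrite ffunE mulrDr.
Qed.


Lemma cupA : associative cup.
Proof.
move=> f g h; apply/ffunP=> s; rewrite !ffunE.
set Y := ysets s.
pose F (T S : {set 'I_n}) :=
  f (push false (Y :\: T) s) *
  (g (push false (Y :\: S) (push true T s)) * h (push true S s)).
transitivity (\sum_(T : {set 'I_n} | T \subset Y)
  \sum_(S : {set 'I_n} | (T \subset S) && (S \subset Y)) F T S).
  apply: eq_bigr => T sT; rewrite ffunE mulr_sumr ysets_push -/Y.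
  rewrite (reindex_onto (fun S => S :\: T) (fun U => U :|: T)) /=; last first.
    move=> U; rewrite subsetD => /andP[_ /setDidPl dU].
    by rewrite setDUl setDv setU0 dU.
  apply: eq_big => [S|S /andP[sS /eqP eS]].
    apply/andP/andP=> [[sS /eqP <-]|[TS SY]].
      rewrite subsetUr subUset sT; split=> //; rewrite andbT.
      by rewrite (subset_trans sS) ?subsetDl.
    rewrite setSD //; split=> //; apply/eqP/setP=> u; rewrite !inE.
    by have := subsetP TS u; case: (u \in T); case: (u \in S) => // /(_ isT).
  rewrite /F; congr (_ * (g _ * h _)).
    apply: push_setI => u; rewrite ysets_push !inE.
    by case: (u \in T); case: (u \in S).
  by rewrite push_pushU eS.
rewrite (exchange_big_dep (fun S : {set _} => S \subset Y)) /=; last by move=> ? ? _ /andP[].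
apply: eq_bigr => S sS; rewrite ffunE mulr_suml ysets_push -/Y.
rewrite setDDr setDv set0U (setIidPr sS).
apply: eq_big => [T|T sT].
  by rewrite sS andbT andbC; case: (boolP (T \subset S)) => //= /subset_trans->.
have TS : T \subset S by case/and3P: sT.
rewrite /F mulrA; congr (f _ * g _ * _).
  rewrite push_pushU; congr (push _ _ _).
  apply/setP=> u; rewrite !inE.
  have /implyP := subsetP TS u; have /implyP := subsetP sS u; rewrite [u \in Y]inE.
  by case: (u \in T); case: (u \in S); case: (is_edge _).
rewrite push_comm // disjoint_sym -setI_eq0; apply/eqP/setP=> u; rewrite !inE.
by have := subsetP TS u; case: (u \in T); case: (u \in S) => // /(_ isT).
Qed.

Lemma sum_setU1 (Y : {set 'I_n}) u (F : {set 'I_n} -> 'F_2) : u \in Y ->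
  \sum_(S : {set 'I_n} | (S \subset Y) && (u \in S)) F S =
  \sum_(S : {set 'I_n} | S \subset Y :\ u) F (u |: S).
Proof.
move=> uY; rewrite (reindex_onto (fun S => u |: S) (fun S => S :\ u)) /=; last first.
  by move=> S /andP[_ uS]; rewrite setD1K.
apply: eq_bigl => S; rewrite setU11 andbT subsetD1 subUset sub1set uY /=.
congr (_ && _); apply/eqP/idP => [<-|uS]; first by rewrite !inE eqxx.
by rewrite setU1K.
Qed.

Lemma delta_cup f g : delta (cup f g) = cup (delta f) g + cup f (delta g).
Proof.
apply/ffunP=> s; rewrite !ffunE; set Y := ysets s.
pose A u S := f (push false (Y :\: S) s) * g (push false [set u] (push true S s)).
pose B u S := f (push true [set u] (push false (Y :\: S) s)) * g (push true S s).
pose C u S := f (push false [set u] (push false (Y :\: S) s)) * g (push true S s).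
pose D u S := f (push false (Y :\: S) s) * g (push true [set u] (push true S s)).
pose SA (F : 'I_n -> {set 'I_n} -> 'F_2) :=
  \sum_(u in Y) \sum_(S : {set 'I_n} | S \subset Y :\ u) F u S.
pose SB (F : 'I_n -> {set 'I_n} -> 'F_2) :=
  \sum_(u in Y) \sum_(S : {set 'I_n} | (S \subset Y) && (u \in S)) F u S.
have -> : \sum_(u in Y) (cup f g (push false [set u] s) + cup f g (push true [set u] s))
        = SA A + SB B.
  rewrite big_split /=; congr (_ + _); apply: eq_bigr => u uY.
    rewrite ffunE ysets_push; apply: eq_bigr => S sS; rewrite /A.
    rewrite push_pushU push_comm; last first.
      by rewrite disjoint_sym disjoints1; move: sS; rewrite subsetD1 => /andP[].
    congr (f (push _ _ _) * _); apply/setP=> w; rewrite !inE.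
    case: eqP => [->|_]; rewrite ?andbF ?orbF //=.
    by move: sS; rewrite subsetD1 => /andP[_ ->]; move: uY; rewrite inE => ->.
  rewrite sum_setU1 // ffunE ysets_push; apply: eq_bigr => S sS; rewrite /B.
  rewrite push_comm; last by rewrite disjoint_sym disjoints1 !inE eqxx andbF.
  rewrite push_pushU setUC; congr (f (push _ _ (push _ _ _)) * _).
  by apply/setP=> w; rewrite !inE negb_or andbCA andbA.
have SBE F : SB F = \sum_(S : {set 'I_n} | S \subset Y) \sum_(u in S) F u S.
  rewrite /SB (exchange_big_dep (fun S : {set _} => S \subset Y)) /=; last by move=> ? ? _ /andP[].
  apply: eq_bigr => S sS; apply: eq_bigl => u; rewrite sS andTb andbC.
  by case: (boolP (u \in S)) => //= /(subsetP sS)->.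
have SAE F : SA F = \sum_(S : {set 'I_n} | S \subset Y) \sum_(u in Y :\: S) F u S.
  rewrite /SA (exchange_big_dep (fun S : {set _} => S \subset Y)) /=; last first.
    by move=> u S _; rewrite subsetD1 => /andP[].
  by apply: eq_bigr => S sS; apply: eq_bigl => u; rewrite subsetD1 sS in_setD andbC.
have -> : \sum_(S : {set 'I_n} | S \subset Y) delta f (push false (Y :\: S) s) * g (push true S s)
        = SB C + SB B.
  rewrite !SBE -big_split; apply: eq_bigr => S sS; rewrite -big_split ffunE mulr_suml.
  rewrite ysets_push setDDr setDv set0U (setIidPr sS).
  by apply: eq_bigr => u uS; rewrite mulrDl.
have -> : \sum_(S : {set 'I_n} | S \subset Y) f (push false (Y :\: S) s) * delta g (push true S s)
        = SA A + SA D.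
  rewrite !SAE -big_split; apply: eq_bigr => S sS; rewrite -big_split ffunE mulr_sumr.
  by rewrite ysets_push; apply: eq_bigr => u uS; rewrite mulrDr.
have -> : SB C = SA D.
  apply: eq_bigr => u uY; rewrite sum_setU1 //; apply: eq_bigr => S sS.
  rewrite /C /D !push_pushU; congr (f (push _ _ _) * _).
  apply/setP=> w; rewrite !inE; case: eqP => [->|_] //=.
  by move: sS; rewrite subsetD1 => /andP[_ ->]; move: uY; rewrite inE => ->.
by rewrite [SA A + SA D]addrC [RHS]addrACA F2_addxx add0r addrC.
Qed.

Lemma delta_is_zmod_morphism : zmod_morphism delta.
Proof.
move=> f g; apply/ffunP=> s; rewrite !ffunE -sumrB; apply: eq_bigr => u _.
by rewrite !ffunE opprD addrACA.
Qed.
HB.instance Definition _ :=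
  GRing.isZmodMorphism.Build cochain cochain delta delta_is_zmod_morphism.

Lemma sum_sym0 (Y : {set 'I_n}) (F : 'I_n -> 'I_n -> 'F_2) :
  (forall u v, F u v = F v u) -> \sum_(u in Y) \sum_(v in Y :\ u) F u v = 0.
Proof.
move=> Fsym; elim: {Y}#|Y| {-2}Y (erefl #|Y|) => [|k IH] Y.
  by move/eqP; rewrite cards_eq0 => /eqP->; rewrite big_set0.
move=> cY; have [u uY] : exists u, u \in Y by apply/card_gt0P; rewrite cY.
rewrite (bigD1 u) //=.
have -> : \sum_(w in Y | w != u) \sum_(v in Y :\ w) F w v
        = \sum_(w in Y :\ u) (F w u + \sum_(v in (Y :\ u) :\ w) F w v).
  rewrite (eq_bigl (mem (Y :\ u))) => [|w]; last by rewrite !inE andbC.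
  apply: eq_bigr => w; rewrite !inE => /andP[wu wY].
  rewrite (bigD1 u) ?inE ?uY 1?eq_sym ?wu //=; congr (_ + _).
  by apply: eq_bigl => v; rewrite !inE andbC andbA [in RHS]andbCA andbA.
rewrite big_split /= IH ?addr0; last first.
  by move: cY; rewrite (cardsD1 u) uY => -[].
by rewrite [X in _ + X](eq_bigr (F u)) ?F2_addxx.
Qed.

Lemma delta_delta f : delta (delta f) = 0.
Proof.
apply/ffunP=> s; rewrite !ffunE.
pose P u b v b' := f (push b [set u] (push b' [set v] s)).
pose F u v := if u == v then 0 else
  P v false u false + P v true u false + (P v false u true + P v true u true).
transitivity (\sum_(u in ysets s) \sum_(v in ysets s :\ u) F u v).
  apply: eq_bigr => u uY; rewrite !ffunE !ysets_push -big_split.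
  apply: eq_bigr => v; rewrite !inE eq_sym => /andP[/negPf vu _].
  by rewrite /F vu.
apply: sum_sym0 => u v; rewrite /F eq_sym; case: eqVneq => // vu.
have PC b b' : P u b v b' = P v b' u b.
  by rewrite /P push_comm // disjoints1 inE eq_sym.
by rewrite !PC addrACA.
Qed.

HB.instance Definition _ := GRing.Zmodule_isPzRing.Build cochain
  cupA cup1c cupc1 cupDl cupDr.

Definition is_cocycle : {pred cochain} := [pred f | delta f == 0].

Lemma cocycle_subring_closed : subring_closed is_cocycle.
Proof.
split=> [|f g|f g]; rewrite !inE.
- apply/eqP/ffunP=> s; rewrite !ffunE big1 // => u _.
  by rewrite !ffunE !ysets_push F2_addxx.
- by move=> /eqP df /eqP dg; rewrite raddfB /= df dg subrr.
- move=> /eqP df /eqP dg; rewrite [f * g]/(cup f g) delta_cup df dg.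
  by rewrite -[cup 0 g]/(0 * g) -[cup f 0]/(f * 0) mul0r mulr0 addr0.
Qed.
HB.instance Definition _ :=
  GRing.isSubringClosed.Build cochain is_cocycle cocycle_subring_closed.

Record cocycle : Type := Cocycle {cocycle_val :> cochain; _ : cocycle_val \in is_cocycle}.
HB.instance Definition _ := [isSub for cocycle_val].
HB.instance Definition _ := [Choice of cocycle by <:].
HB.instance Definition _ := GRing.SubChoice_isSubPzRing.Build cochain is_cocycle cocycle
  cocycle_subring_closed.

Definition is_coboundary : {pred cocycle} :=
  [pred z : cocycle | [exists f : cochain, val z == delta f]].

Lemma coboundaryP z : reflect (exists f, val z = delta f) (z \in is_coboundary).
Proof. by apply: (iffP existsP) => -[f /eqP]; exists f => //; apply/eqP. Qed.

Lemma coboundary_zmod_closed : zmod_closed is_coboundary.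
Proof.
split=> [|y z /coboundaryP[f yf] /coboundaryP[g zg]]; apply/coboundaryP.
  by exists 0; rewrite !raddf0.
by exists (f - g); rewrite !raddfB /= yf zg.
Qed.
HB.instance Definition _ :=
  GRing.isZmodClosed.Build cocycle is_coboundary coboundary_zmod_closed.

Lemma coboundaryMl y z : z \in is_coboundary -> y * z \in is_coboundary.
Proof.
case: y => y /= yZ /coboundaryP[f zf]; apply/coboundaryP; exists (y * f).
rewrite rmorphM /= zf [in RHS]/GRing.mul /= delta_cup.
by move: yZ; rewrite inE => /eqP->; rewrite -[cup 0 f]/(0 * f) mul0r add0r.
Qed.

Lemma coboundaryMr y z : z \in is_coboundary -> z * y \in is_coboundary.
Proof.
case: y => y /= yZ /coboundaryP[f zf]; apply/coboundaryP; exists (f * y).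
rewrite rmorphM /= zf [in RHS]/GRing.mul /= delta_cup.
by move: yZ; rewrite inE => /eqP->; rewrite -[cup f 0]/(f * 0) mulr0 addr0.
Qed.

(* The total cohomology ring H^*, the direct sum of all H^k: cocycles modulo
   coboundaries. MathComp does not provide the quotient of a noncommutative ring
   by a two-sided ideal, so the product is put on the additive quotient. *)
Definition cohomology : Type := Quotient.quot is_coboundary.
HB.instance Definition _ := GRing.Zmodule.on cohomology.
HB.instance Definition _ := EqQuotient.on cohomology.

Definition coh_one : cohomology := \pi_cohomology 1.
(* [coh_mul x y] is [\pi (repr x * repr y)]; see [coh_piM]. *)
Definition coh_mul := lift_op2 cohomology *%R.

Lemma coh_eqP (y z : cocycle) :
  reflect (\pi_cohomology y = \pi_cohomology z) (y - z \in is_coboundary).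
Proof. by rewrite Quotient.idealrBE; apply: eqP. Qed.

Lemma coh_piD : {morph \pi_cohomology : y z / y + z}.
Proof. exact: raddfD. Qed.

Lemma coh_piM (y z : cocycle) :
  \pi_cohomology (y * z) = coh_mul (\pi_cohomology y) (\pi_cohomology z).
Proof.
unlock coh_mul; apply/coh_eqP; set y' := repr _; set z' := repr _.
have -> : y * z - y' * z' = (y - y') * z + y' * (z - z').
  by rewrite mulrBl mulrBr addrA subrK.
by rewrite rpredD //; [apply: coboundaryMr | apply: coboundaryMl]; apply/coh_eqP;
  rewrite reprK.
Qed.

Lemma coh_mulA : associative coh_mul.
Proof.
by move=> x y z; rewrite -[x]reprK -[y]reprK -[z]reprK -!coh_piM mulrA.
Qed.

Lemma coh_mul1 : left_id coh_one coh_mul.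
Proof. by move=> x; rewrite -[x]reprK -coh_piM mul1r. Qed.

Lemma coh_1mul : right_id coh_one coh_mul.
Proof. by move=> x; rewrite -[x]reprK -coh_piM mulr1. Qed.

Lemma coh_mulDl : left_distributive coh_mul +%R.
Proof.
move=> x y z; rewrite -[x]reprK -[y]reprK -[z]reprK.
by rewrite -coh_piD -!coh_piM -coh_piD mulrDl.
Qed.

Lemma coh_mulDr : right_distributive coh_mul +%R.
Proof.
move=> x y z; rewrite -[x]reprK -[y]reprK -[z]reprK.
by rewrite -coh_piD -!coh_piM -coh_piD mulrDr.
Qed.

HB.instance Definition _ := GRing.Zmodule_isPzRing.Build cohomology
  coh_mulA coh_mul1 coh_1mul coh_mulDl coh_mulDr.

(* The class of a cocycle; by [insubd] the value is 0 on other cochains. *)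
Definition coh_class (f : cochain) : cohomology :=
  \pi_cohomology (insubd (0 : cocycle) f).

Definition is_min (A : {set 'I_n}) (a : 'I_n) : bool :=
  (a \in A) && [forall u in A, (a <= u)%N].
Definition is_max (A : {set 'I_n}) (a : 'I_n) : bool :=
  (a \in A) && [forall u in A, (u <= a)%N].

Definition moved (a : 'I_n) (l : loc) (s t : cell) : bool :=
  val t == [ffun u => if u == a then l else s u].

(* [Wpair s t] holds when s is the lower and t the upper member of a pair. *)
Definition Wpair (s t : cell) : bool :=
  if xset v1 s :|: yset v1 s != set0 then
    [exists a, [&& is_min (xset v1 s :|: yset v1 s) a, a \in xset v1 s
      & moved a (edge v1) s t]]
  else if xset v2 s :|: yset v2 s != set0 then
    [exists a, [&& is_min (xset v2 s :|: yset v2 s) a, a \in xset v2 s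
      & moved a (edge v2) s t]]
  else
    [exists a, is_min (xset v3 s :|: yset v3 s) a &&
      ([&& a \in xset v3 s, (2 <= #|xset v3 s|)%N & moved a (edge v3) s t]
       || (xset v3 s == [set a]) &&
          [exists b, [&& is_max (yset v3 s :|: xset v4 s) b, b \in xset v4 s,
            (2 <= #|xset v4 s|)%N, (a < b)%N & moved b (edge v3) s t]])].

Definition critical (s : cell) : bool :=
  [forall t, ~~ Wpair s t && ~~ Wpair t s].

Definition upper_step (t t' : cell) : bool :=
  (t != t') && [exists m, Wpair t m && face t' m].

(* The path t = t_1, ..., t_q = s is represented by p = t_2, ..., t_q. *)
Definition upper_path (t s : cell) (p : seq cell) : bool :=
  path upper_step t p && (last t p == s).

(* By [upper_path_size] below every upper path is counted here. *)
Definition num_upper_paths (t s : cell) : nat :=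
  \sum_(k < #|{: cell}|) #|[set p : k.-tuple cell | upper_path t s p]|.

(* Upper paths preserve the dimension, so this is supported on the cells of
   dimension [cell_dim s] (see [upper_step_dim]). *)
Definition dual_cochain (s : cell) : cochain :=
  [ffun t : cell => (num_upper_paths t s)%:R].

Definition dual_class (s : cell) : cohomology := coh_class (dual_cochain s).

Definition weight (l : loc) : nat :=
  if l == edge v4 then 3 else
  if (l == vtx v1) || (l == edge v1) then 2 else
  if (l == vtx v2) || (l == edge v2) then 1 else 0.

Definition total_weight (s : cell) : nat := \sum_u weight (s u).
Definition upset3 (s : cell) : {set 'I_n} :=
  [set u : 'I_n | [exists w in xset v3 s :|: yset v3 s, (w <= u)%N]].

Definition cell_lt (s t : cell) : Prop :=
  (total_weight s < total_weight t)%N \/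
  (total_weight s <= total_weight t)%N /\
  ((#|upset3 s| < #|upset3 t|)%N \/
   (#|upset3 s| <= #|upset3 t|)%N /\ (#|xset v3 t| < #|xset v3 s|)%N).

Lemma cell_lt_trans r s t : cell_lt r s -> cell_lt s t -> cell_lt r t.
Proof. rewrite /cell_lt; lia. Qed.

Lemma cell_lt_irr s : ~ cell_lt s s.
Proof. rewrite /cell_lt; lia. Qed.

Lemma locP (l : loc) : [\/ l = vtx v1, l = vtx v2, l = vtx v3 | l = vtx v4] \/
  [\/ l = edge v1, l = edge v2, l = edge v3 | l = edge v4].
Proof.
by case: l => -[[|[|[|[|m]]]] im] //; [left|left|left|left|right|right|right|right];
  [constructor 1|constructor 2|constructor 3|constructor 4
  |constructor 1|constructor 2|constructor 3|constructor 4]; congr (_ _); apply: val_inj.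
Qed.

Lemma total_weight_upd (s t : cell) u : (forall w, w != u -> s w = t w) ->
  (total_weight s + weight (t u) = total_weight t + weight (s u))%N.
Proof.
move=> st; rewrite /total_weight (bigD1 u) //= [in RHS](bigD1 u) //=.
rewrite (eq_bigr (fun w => weight (t w))) => [|w wu]; last by rewrite st.
by rewrite addnAC [RHS]addnAC [(weight (s u) + _)%N]addnC.
Qed.

Lemma is_min_inj A a b : is_min A a -> is_min A b -> a = b.
Proof.
move=> /andP[aA /forall_inP am] /andP[bA /forall_inP bm].
by apply/val_inj/eqP; rewrite eqn_leq am ?bm.
Qed.

Lemma is_max_inj A a b : is_max A a -> is_max A b -> a = b.
Proof.
move=> /andP[aA /forall_inP am] /andP[bA /forall_inP bm].
by apply/val_inj/eqP; rewrite eqn_leq am ?bm.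
Qed.

Lemma movedE a l s t u : moved a l s t -> t u = if u == a then l else s u.
Proof. by rewrite /moved => /eqP /= ->; rewrite ffunE. Qed.

Lemma endpoint_true3 : endpoint true (edge v3) = vtx v4.
Proof. by congr inl; apply: val_inj. Qed.

Lemma weight_endpoint b l : (weight (endpoint b l) < weight l)%N \/
  weight (endpoint b l) = weight l /\
  (endpoint b l = l \/ l = edge v1 /\ b = false \/ l = edge v2 /\ b = false \/ l = edge v3).
Proof.
by case: (locP l) => -[]->; case: b;
  first [by left | right; split; [by []|tauto]].
Qed.

Lemma upper_step_lt t t' m m' :
  Wpair t m -> face t' m -> t != t' -> Wpair t' m' -> cell_lt t' t.
Proof.
move=> Wt /exists_inP[u]; rewrite inE => um t't tt' Wt'.
have [b t'E] : exists b, t' = push b [set u] m.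
  by case/orP: t't => /eqP->; [exists false | exists true].
have {t'E}tE w : t' w = if w == u then endpoint b (m w) else m w.
  by rewrite t'E pushE inE.
have wt' : (total_weight t' + weight (m u) = total_weight m + weight (endpoint b (m u)))%N.
  by rewrite (@total_weight_upd t' m u) => [|w /negPf wu]; rewrite tE ?eqxx // wu.
have ub : (weight (endpoint b (m u)) < weight (m u))%N \/
   weight (endpoint b (m u)) = weight (m u) /\
   (m u = edge v1 /\ b = false \/ m u = edge v2 /\ b = false \/ m u = edge v3).
  case: (weight_endpoint b (m u)) => [|[-> [e|e]]]; [by left | | by right].
  by move: um e; case: (m u).
have wm a l : moved a l t m -> weight l = weight (t a) -> total_weight m = total_weight t.
  move=> mv wl; have := @total_weight_upd m t a; rewrite (movedE _ mv) eqxx wl => H.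
  by apply/eqP; rewrite -(eqn_add2r (weight (t a))) H // => w /negPf wa; rewrite (movedE _ mv) wa.
have tt'P : exists w, t w != t' w.
  apply/existsP; apply: contraR tt'; rewrite negb_exists => /forallP H.
  by apply/eqP/cell_eqP => w; apply/eqP; rewrite -[_ == _]negbK.
pose reg i l := (l == vtx i) || (l == edge i).
have BE a l i : moved a l t m -> (i == v1) || (i == v2) -> reg i l = reg i (t a) ->
    m u = edge v1 /\ b = false \/ m u = edge v2 /\ b = false \/ m u = edge v3 ->
    xset i t' :|: yset i t' = xset i t :|: yset i t.
  move=> mv i12 rl ub'; apply/setP=> w; rewrite !inE -!/(reg _ _).
  have -> : reg i (t' w) = reg i (m w).
    rewrite tE; case: (eqVneq w u) => // ->.
    by case: ub' => [[-> ->]|[[-> ->]|->]]; case/orP: i12 => /eqP->; case: (b).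
  by rewrite (movedE w mv); case: (eqVneq w a) => // ->.
have low12 i a : (i == v1) || (i == v2) -> a \in xset i t -> moved a (edge i) t m ->
    m u = edge v1 /\ b = false \/ m u = edge v2 /\ b = false \/ m u = edge v3 ->
    t' a = edge i.
  rewrite inE => i12 /eqP ta mv ub'.
  rewrite tE (movedE _ mv) eqxx; case: (eqVneq a u) => // au.
  case: tt'P => w /eqP[]; rewrite tE; case: (eqVneq w u) => [->|wu].
    move: ub'; rewrite -au (movedE _ mv) eqxx ta.
    by case/orP: i12 => /eqP-> [[_ ->]|[[_ ->]|]].
  by rewrite (movedE _ mv) au (negPf wu).
move: Wt; rewrite /Wpair; case: ifPn => [B1 /existsP[a /and3P[amin ax mv]]|B1].
  have ta : t a = vtx v1 by move: (ax); rewrite inE => /eqP.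
  have wtm : total_weight m = total_weight t by apply: wm mv _; rewrite ta.
  case: ub => [ww|[ww ub]]; first by left; rewrite -wtm -(ltn_add2r (weight (m u))) wt' ltn_add2l.
  have a'E := low12 v1 a isT ax mv ub.
  move: Wt'; rewrite /Wpair (BE _ _ v1 mv isT _ ub) ?ta // B1.
  move=> /existsP[a' /and3P[a'min a'x _]].
  by move: a'x; rewrite -(is_min_inj amin a'min) inE a'E.
case: ifPn => [B2 /existsP[a /and3P[amin ax mv]]|B2].
  have ta : t a = vtx v2 by move: (ax); rewrite inE => /eqP.
  have wtm : total_weight m = total_weight t by apply: wm mv _; rewrite ta.
  case: ub => [ww|[ww ub]]; first by left; rewrite -wtm -(ltn_add2r (weight (m u))) wt' ltn_add2l.
  have a'E := low12 v2 a isT ax mv ub.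
  move: Wt'; rewrite /Wpair (BE _ _ v1 mv isT _ ub) ?ta // (BE _ _ v2 mv isT _ ub) ?ta // (negPf B1) B2.
  move=> /existsP[a' /and3P[a'min a'x _]].
  by move: a'x; rewrite -(is_min_inj amin a'min) inE a'E.
case/existsP=> a /andP[amin].
have lowW l c : moved c l t m -> weight l = 0%N -> weight (t c) = 0%N ->
    reg v1 l = reg v1 (t c) -> reg v2 l = reg v2 (t c) -> cell_lt t' t \/
  [/\ total_weight t' = total_weight t, m u = edge v3 &
     exists2 a', is_min (xset v3 t' :|: yset v3 t') a' & 
      a' \in xset v3 t' /\ ((2 <= #|xset v3 t'|)%N \/
          exists2 b', is_max (yset v3 t' :|: xset v4 t') b' & b' \in xset v4 t')].
  move=> mv wl wc r1 r2.
  have wtm : total_weight m = total_weight t by apply: wm mv _; rewrite wc.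
  case: ub => [ww|[ww ub]]; first by left; left; rewrite -wtm -(ltn_add2r (weight (m u))) wt' ltn_add2l.
  right.
  have E1 := BE _ _ v1 mv isT r1 ub; have E2 := BE _ _ v2 mv isT r2 ub.
  split; first by apply/eqP; rewrite -wtm -(eqn_add2r (weight (m u))) wt' ww.
    have nB i : ~~ (xset i t :|: yset i t != set0) -> xset i t' :|: yset i t' = xset i t :|: yset i t ->
       m u = edge i -> b = false -> False.
      move=> /negPn/eqP-> /setP/(_ u) H1 H2 H3.
      by move: H1; rewrite !inE tE eqxx H2 H3 /= eqxx.
    by case: ub => [[H H']|[[H H']|]] //; [case: (nB v1) | case: (nB v2)].
  move: Wt'; rewrite /Wpair E1 E2 (negPf B1) (negPf B2) => /existsP[a' /andP[a'min H]].
  exists a' => //; case/orP: H => [/and3P[? ? _]|/andP[/eqP e /existsP[b' /and5P[? ? _ _ _]]]].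
    by split=> //; left.
  by rewrite e inE eqxx; split=> //; right; exists b'.
case/orP=> [/and3P[ax x2 mv]|/andP[/eqP xa /existsP[c /and5P[cmax cx x2 ac mv]]]].
  have ta : t a = vtx v3 by move: (ax); rewrite inE => /eqP.
  case: (lowW _ _ mv); rewrite ?ta // => -[wt mu [a' a'min [a'x _]]].
  have sub w : w \in xset v3 t' :|: yset v3 t' -> w \in xset v3 t :|: yset v3 t.
    rewrite !inE tE (movedE w mv); case: (eqVneq w u) => [->|_].
      move: mu; rewrite (movedE u mv); case: (eqVneq u a) => [->|_ ->]; first by rewrite ta.
      by rewrite orbT.
    by case: (eqVneq w a) => // ->; rewrite ta.
  have a'a : a' != a.
    apply/eqP=> e; move: a'x; rewrite e inE tE (movedE _ mv) eqxx.
    case: (eqVneq a u) => [au|//]; case bE : b => // _.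
    case: tt'P => w /eqP[]; rewrite tE (movedE w mv) -au bE.
    by case: (eqVneq w a) => // ->.
  right; split; first by rewrite wt.
  left; apply: proper_card; apply/properP; split.
    apply/subsetP=> w; rewrite !inE => /exists_inP[v vB vw].
    by apply/exists_inP; exists v => //; apply: sub.
  exists a; rewrite inE; first by apply/exists_inP; exists a => //; case/andP: amin.
  apply/exists_inP=> -[w wB wa].
  case/andP: amin => aB /forall_inP am; case/andP: a'min => a'B /forall_inP a'm.
  move/negP: a'a; apply; apply/eqP/val_inj/eqP; rewrite eqn_leq (am _ (sub _ a'B)) andbT.
  exact: leq_trans (a'm _ wB) wa.
have tc : t c = vtx v4 by move: (cx); rewrite inE => /eqP.
have ta : t a = vtx v3 by have := set11 a; rewrite -xa inE => /eqP.
case: (lowW _ _ mv); rewrite ?tc // => -[wt mu [a' a'min [a'x H]]].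
have ca : c != a by apply: contraL ac => /eqP->; rewrite ltnn.
have [cu|cu] := eqVneq c u.
  have t'c : t' c = vtx v3.
    rewrite tE -cu eqxx (movedE _ mv) eqxx; case bE : b => //.
    case: tt'P => w /eqP[]; rewrite tE (movedE w mv) -cu bE.
    by case: (eqVneq w c) => // ->; rewrite endpoint_true3.
  have t'w w : w != c -> t' w = t w.
    by move=> wc; rewrite tE (movedE w mv) -cu (negPf wc).
  right; split; first by rewrite wt.
  right; split.
    apply/subset_leq_card/subsetP=> w; rewrite !inE => /exists_inP[v vB vw].
    have [vc|vc] := eqVneq v c; last first.
      by apply/exists_inP; exists v => //; move: vB; rewrite !inE t'w.
    apply/exists_inP; exists a; first by case/andP: amin.
    by apply: leq_trans vw; rewrite vc ltnW.
  apply: proper_card; apply/properP; split; last by exists c; rewrite inE ?t'c ?tc.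
  by rewrite xa sub1set inE t'w ?ta // eq_sym.
have t'c : t' c = edge v3 by rewrite tE (negPf cu) (movedE _ mv) eqxx.
have uc : u != c by rewrite eq_sym.
have tu : t u = edge v3 by rewrite -mu (movedE _ mv) (negPf uc).
have t'w w : w != c -> w != u -> t' w = t w.
  by move=> wc wu; rewrite tE (movedE w mv) (negPf wc) (negPf wu).
have au : a != u by apply/eqP=> e; move: tu; rewrite -e ta.
have t'a : t' a = vtx v3 by rewrite t'w // eq_sym.
case bE : b; last first.
  have t'u : t' u = vtx v3 by rewrite tE eqxx mu bE.
  right; split; first by rewrite wt.
  right; split.
    apply/subset_leq_card/subsetP=> w; rewrite !inE => /exists_inP[v vB vw].
    have [vc|vc] := eqVneq v c.
      apply/exists_inP; exists a; first by case/andP: amin.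
      by apply: leq_trans vw; rewrite vc ltnW.
    apply/exists_inP; exists v => //; have [->|vu] := eqVneq v u.
      by rewrite !inE tu orbT.
    by move: vB; rewrite !inE t'w.
  apply: proper_card; apply/properP; split; last by exists u; rewrite inE ?t'u ?tu.
  by rewrite xa sub1set inE t'a.
have t'u : t' u = vtx v4 by rewrite tE eqxx mu bE endpoint_true3.
have x3E : xset v3 t' = [set a].
  rewrite -xa; apply/setP=> w; rewrite !inE.
  have [->|wc] := eqVneq w c; first by rewrite t'c tc.
  have [->|wu] := eqVneq w u; first by rewrite t'u tu.
  by rewrite t'w.
have BmE : yset v3 t' :|: xset v4 t' = yset v3 t :|: xset v4 t.
  apply/setP=> w; rewrite !inE.
  have [->|wc] := eqVneq w c; first by rewrite t'c tc.
  have [->|wu] := eqVneq w u; first by rewrite t'u tu.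
  by rewrite t'w.
case: H; first by rewrite x3E cards1.
rewrite BmE => -[b' b'max].
by rewrite -(is_max_inj cmax b'max) inE t'c.
Qed.

Lemma path_lower_lt t p x : path upper_step t p -> x \in p ->
  (exists m, Wpair x m) -> cell_lt x t.
Proof.
elim: p t => //= y p IH t /andP[/andP[ty /existsP[m /andP[Wm ym]]] pp].
rewrite inE => /orP[/eqP->|xp] [m' Wm'].
  exact: upper_step_lt Wm ym ty Wm'.
have xy : cell_lt x y by apply: IH => //; exists m'.
apply: cell_lt_trans xy _; case: p pp xp {IH} => //= z p /andP[/andP[_ /existsP[m2 /andP[Wm2 _]]] _] _.
exact: upper_step_lt Wm ym ty Wm2.
Qed.

(* W is acyclic: upper paths have no repetition. *)
Lemma upper_path_uniq t p : path upper_step t p -> uniq (t :: p).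
Proof.
elim: p t => // y p IH t /= /andP[ty pp]; rewrite -/(uniq (y :: p)) IH // andbT.
apply/negP=> tp; apply: (@cell_lt_irr t).
apply: (path_lower_lt (p := y :: p)) => //=; first by rewrite ty.
by case/andP: ty => _ /existsP[m /andP[Wm _]]; exists m.
Qed.

Lemma upper_path_size t s p : upper_path t s p -> (size p < #|{: cell}|)%N.
Proof.
case/andP => /upper_path_uniq/card_uniqP e _.
by rewrite -[(size p).+1]/(size (t :: p)) -e; apply: max_card.
Qed.

Lemma Wpair_moved s t : Wpair s t ->
  exists a k i, s a = vtx k /\ moved a (edge i) s t.
Proof.
rewrite /Wpair; case: ifP => _; last case: ifP => _.
- by case/existsP=> a /and3P[_ H mv]; exists a, v1, v1; move: H; rewrite inE => /eqP.
- by case/existsP=> a /and3P[_ H mv]; exists a, v2, v2; move: H; rewrite inE => /eqP.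
case/existsP=> a /andP[_ /orP[/and3P[H _ mv]|/andP[_ /existsP[b /and5P[_ H _ _ mv]]]]].
  by exists a, v3, v3; move: H; rewrite inE => /eqP.
by exists b, v4, v3; move: H; rewrite inE => /eqP.
Qed.

Lemma Wpair_dim s t : Wpair s t -> cell_dim t = (cell_dim s).+1.
Proof.
case/Wpair_moved=> a [k [i [sa mv]]].
rewrite /cell_dim (cardsD1 a (ysets t)) inE (movedE _ mv) eqxx; congr (_.+1).
apply: eq_card => u; rewrite !inE (movedE _ mv).
by case: (eqVneq u a) => // ->; rewrite sa.
Qed.

Lemma face_dim t s : face t s -> cell_dim s = (cell_dim t).+1.
Proof.
case/exists_inP=> u us /orP[]/eqP->;
  by rewrite /cell_dim ysets_push (cardsD1 u (ysets s)) us.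
Qed.

Lemma upper_step_dim t t' : upper_step t t' -> cell_dim t' = cell_dim t.
Proof.
by case/andP=> _ /existsP[m /andP[/Wpair_dim tm /face_dim]]; rewrite tm => -[].
Qed.

End Complex.

(* Main.v *)
(** For a set D of labels let f_D be the cochain that is 1 on the cells whose
    edge labels are exactly D, all of them on the edge from 4 to 1. Every f_D is
    a cocycle, since opposite faces get equal values, and f_D f_E = f_(D u E) on
    the nose for disjoint D and E. The upper member of a pair of W has a label on
    an edge other than this one, so f_D vanishes on it; and when |D| < n - 2, f_D
    is 1 on a single critical cell. A cocycle vanishing on upper members is
    determined, through the recursion along upper paths, by its values on
    critical cells, so f_D is the dual cochain of that critical cell. *)

Require Import Defs.
From mathcomp Require Import all_boot all_order all_algebra zify.

Import GRing.Theory.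
Local Open Scope ring_scope.

Set Implicit Arguments.
Unset Strict Implicit.
Unset Printing Implicit Defensive.

Section Matching.
Variable n : nat.
Implicit Types (s t m : cell n) (c : cochain n) (A D : {set 'I_n}).

(** * Partners in the matching *)

Lemma is_min_exists A : A != set0 -> exists a, is_min A a.
Proof.
case/set0Pn=> x xA; case: (arg_minnP (fun u : 'I_n => u : nat) xA) => a aA am.
by exists a; apply/andP; split=> //; apply/forall_inP.
Qed.

Lemma is_max_exists A : A != set0 -> exists a, is_max A a.
Proof.
case/set0Pn=> x xA; case: (arg_maxnP (fun u : 'I_n => u : nat) xA) => a aA am.
by exists a; apply/andP; split=> //; apply/forall_inP.
Qed.

Lemma moved_inj a l s t t' : moved a l s t -> moved a l s t' -> t = t'.
Proof. by move=> /eqP e /eqP e'; apply: val_inj; rewrite e e'. Qed.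

Lemma Wpair_inj s t t' : Wpair s t -> Wpair s t' -> t = t'.
Proof.
rewrite /Wpair; case: ifP => _; last case: ifP => _.
- move=> /existsP[a /and3P[am _ mv]] /existsP[b /and3P[bm _ mv']].
  by rewrite -(is_min_inj am bm) in mv'; apply: moved_inj mv mv'.
- move=> /existsP[a /and3P[am _ mv]] /existsP[b /and3P[bm _ mv']].
  by rewrite -(is_min_inj am bm) in mv'; apply: moved_inj mv mv'.
move=> /existsP[a /andP[am H]] /existsP[a' /andP[am' H']].
rewrite -{a' am'}(is_min_inj am am') in H'.
case/orP: H H' => [/and3P[_ x2 mv]|/andP[/eqP xa /existsP[b /and5P[bm _ _ _ mv]]]].
  case/orP=> [/and3P[_ _ mv']|/andP[/eqP xa _]]; first exact: moved_inj mv mv'.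
  by rewrite xa cards1 in x2.
case/orP=> [/and3P[_ x2 _]|/andP[_ /existsP[b' /and5P[bm' _ _ _ mv']]]].
  by rewrite xa cards1 in x2.
by rewrite -(is_max_inj bm bm') in mv'; apply: moved_inj mv mv'.
Qed.

Lemma moved_push b a i s t :
  moved a (edge i) s t -> s a = endpoint b (edge i) -> s = push b [set a] t.
Proof.
move=> mv sa; apply: cell_eqP => u; rewrite pushE inE (movedE u mv).
by case: eqVneq => [->|].
Qed.

(** The conclusion [i != v4] is what matters later: no rule of W moves a label onto the edge from 4
    to 1. The push goes to the end point ([b = true]) only for rule (3b), where the label comes from
    vertex 4. *)
Lemma Wpair_push s t : Wpair s t ->
  exists a i b, [/\ i != v4, t a = edge i & s = push b [set a] t].
Proof.
rewrite /Wpair; case: ifP => _; last case: ifP => _.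
- case/existsP=> a /and3P[_ + mv]; rewrite inE => /eqP sa; exists a, v1, false.
  by split=> //; [rewrite (movedE _ mv) eqxx | exact: (moved_push (b := false) mv)].
- case/existsP=> a /and3P[_ + mv]; rewrite inE => /eqP sa; exists a, v2, false.
  by split=> //; [rewrite (movedE _ mv) eqxx | exact: (moved_push (b := false) mv)].
case/existsP=> a /andP[_ /orP[/and3P[+ _ mv]|/andP[_ /existsP[b /and5P[_ + _ _ mv]]]]].
  rewrite inE => /eqP sa; exists a, v3, false.
  by split=> //; [rewrite (movedE _ mv) eqxx | exact: (moved_push (b := false) mv)].
rewrite inE => /eqP sb; exists b, v3, true.
split=> //; first by rewrite (movedE _ mv) eqxx.
by apply: (moved_push (b := true) mv); rewrite endpoint_true3.
Qed.

Lemma Wpair_face s t : Wpair s t -> face s t.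
Proof.
case/Wpair_push=> a [i [b [_ ta ->]]]; apply/exists_inP; exists a; first by rewrite inE ta.
by case: b; rewrite eqxx ?orbT.
Qed.

(** * Coboundaries, upper paths and dual cochains *)

Lemma push_face_inj s (p q : bool * 'I_n) :
  p.2 \in ysets s -> q.2 \in ysets s ->
  push p.1 [set p.2] s = push q.1 [set q.2] s -> p = q.
Proof.
case: p q => [b u] [b' u'] /= uY u'Y e.
have uu' : u = u'.
  have: u \notin ysets (push b' [set u'] s) by rewrite -e ysets_push !inE eqxx.
  by rewrite ysets_push in_setD uY andbT negbK inE => /eqP.
have := congr1 (fun t : cell n => t u) e; rewrite -uu' !pushE set11.
move: uY; rewrite inE; case: (s u) => // i _ [] bb'; congr pair => //.
by case: b b' bb' {e} => -[] //; case: i => -[|[|[|[|?]]]].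
Qed.

(** Different choices of an edge label and an end give different faces, so no two terms of [delta]
    cancel mod 2. *)
Lemma delta_faces c s : delta c s = \sum_(t | face t s) c t.
Proof.
rewrite ffunE.
pose P := [pred p : bool * 'I_n | p.2 \in ysets s].
pose h (p : bool * 'I_n) := push p.1 [set p.2] s.
have -> : \sum_(t | face t s) c t = \sum_(t in [set h p | p in P]) c t.
  apply: eq_bigl => t; apply/exists_inP/imsetP => [[u uY]|[[b u] /= uY ->]].
    by case/orP=> /eqP->; [exists (false, u) | exists (true, u)].
  by exists u => //; rewrite /h /=; case: (b); rewrite eqxx ?orbT.
rewrite big_imset /=; last by move=> p q; apply: push_face_inj.
rewrite -(pair_big_dep xpredT (fun _ u => u \in ysets s) (fun b u => c (h (b, u)))) /=.
by rewrite exchange_big; apply: eq_bigr => u _; rewrite big_bool addrC.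
Qed.

Definition num_paths (k : nat) t s : nat := #|[set p : k.-tuple (cell n) | upper_path t s p]|.

Lemma num_paths0 t s : num_paths 0 t s = (t == s).
Proof.
rewrite /num_paths; case: eqVneq => [->|ts].
  have -> : [set p : 0.-tuple (cell n) | upper_path s s p] = setT.
    by apply/setP=> p; rewrite !inE tuple0 /upper_path /= eqxx.
  by rewrite cardsT card_tuple.
by apply: eq_card0 => p; rewrite !inE tuple0 /upper_path /= (negPf ts).
Qed.

Lemma num_pathsS k t s :
  num_paths k.+1 t s = (\sum_(t' | upper_step t t') num_paths k t' s)%N.
Proof.
transitivity (\sum_(p : k.+1.-tuple (cell n) | upper_path t s p) 1)%N.
  by rewrite sum1_card /num_paths cardsE.
rewrite (partition_big (fun p : k.+1.-tuple (cell n) => thead p) (upper_step t)) /=; last first.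
  by move=> p; case/tupleP: p => x p; rewrite theadE /upper_path /= => /andP[/andP[]].
apply: eq_bigr => t' tt'.
rewrite /num_paths cardsE -sum1_card.
rewrite (reindex_onto (fun p : k.-tuple (cell n) => [tuple of t' :: p])
  (fun p : k.+1.-tuple (cell n) => [tuple of behead p])) /=; last first.
  by move=> p /andP[_ /eqP <-]; rewrite [RHS]tuple_eta.
apply: eq_bigl => p; rewrite theadE eqxx andbT /upper_path /= tt' /=.
have -> : [tuple of behead [tuple of t' :: p]] = p by apply: val_inj.
by rewrite eqxx andbT.
Qed.

(** A path is either trivial or has a first step, after which it continues as an arbitrary upper
    path. *)
Lemma num_upper_paths_rec t s :
  num_upper_paths t s = ((t == s) + \sum_(t' | upper_step t t') num_upper_paths t' s)%N.
Proof.
rewrite /num_upper_paths exchange_big /=.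
under [in RHS]eq_bigr => k _ do rewrite -/(num_paths k _ s) -num_pathsS.
rewrite -(num_paths0 t s).
under eq_bigr => k _ do rewrite -/(num_paths k t s).
rewrite -(big_mkord xpredT (fun k => num_paths k t s)).
rewrite -(big_mkord xpredT (fun k => num_paths k.+1 t s)).
rewrite -(big_nat_recl #|{: cell n}| 0 (fun k => num_paths k t s)) // big_nat_recr //=.
(* Splitting off a step shifts the range of lengths by one. The surplus term counts paths with as
   many steps as there are cells; acyclicity excludes them. *)
rewrite [X in (_ + X)%N](_ : _ = 0)%N ?addn0 //.
apply: eq_card0 => p; rewrite inE; apply/negP => /upper_path_size.
by rewrite size_tuple ltnn.
Qed.

(* Closedness of [c] at the cell matched with a lower cell [t] reads
   [c t = \sum_(t' | upper_step t t') c t'], which is the recursion satisfied by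
   the number of upper paths. *)
Lemma dual_cochain_unique s c :
  critical s -> delta c = 0 ->
  (forall r t, Wpair r t -> c t = 0) ->
  (forall t, critical t -> c t = (t == s)%:R) ->
  dual_cochain s = c.
Proof.
move=> sc dc cupper0 ccrit.
have crec t : c t = (t == s)%:R + \sum_(t' | upper_step t t') c t'.
  have [m Wm|noW] := pickP (Wpair t).
    have -> : (t == s) = false.
      by apply/eqP=> ts; move/forallP: sc => /(_ m); rewrite -ts Wm.
    have: delta c m = 0 by rewrite dc ffunE.
    rewrite delta_faces (bigD1 t) ?Wpair_face //= add0r => cm.
    (* Over ['F_2] the sum may be added twice; one copy cancels [c t] by closedness at [m]. *)
    rewrite -[LHS]addr0 -[in LHS](F2_addxx (\sum_(t' | upper_step t t') c t')) addrA.
    rewrite [X in _ + X + _](_ : _ = \sum_(t' | face t' m && (t' != t)) c t') ?cm ?add0r //.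
    apply: eq_bigl => t'; rewrite /upper_step andbC eq_sym; congr (_ && _).
    apply/existsP/idP => [[m' /andP[Wm']]|t'm]; first by rewrite (Wpair_inj Wm Wm').
    by exists m; rewrite Wm.
  (* A cell that is not a lower member starts no upper step; it is an upper member or critical, and
     its value is prescribed. *)
  rewrite big_pred0 ?addr0; last first.
    by move=> t'; rewrite /upper_step; apply/andP=> -[_ /existsP[m]]; rewrite noW.
  have [r Wr|noW'] := pickP (fun r => Wpair r t).
    rewrite (cupper0 _ _ Wr); case: eqP => // ts.
    by move/forallP: sc => /(_ r); rewrite -ts Wr andbF.
  by apply: ccrit; apply/forallP=> m; rewrite noW noW'.
(* Induction on a strict bound for the lengths of upper paths from [t]. For [k = 0] the empty path
   contradicts the bound. *)
have H k t : (forall p, path (@upper_step n) t p -> (size p < k)%N) -> (num_upper_paths t s)%:R = c t.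
  elim: k t => [|k IH] t Hp; first by have := Hp [::] isT.
  rewrite num_upper_paths_rec natrD natr_sum crec; congr (_ + _).
  apply: eq_bigr => t' tt'; apply: IH => p pp.
  by have := Hp (t' :: p); rewrite /= tt' pp ltnS; apply.
apply/ffunP=> t; rewrite ffunE; apply: (H #|{: cell n}|) => p pp.
by apply: (@upper_path_size _ t (last t p)); rewrite /upper_path pp eqxx.
Qed.

(** * Critical cells with all edge labels on the edge from 4 to 1 *)

Lemma moved_exists a l s p q :
  p != a -> q != a -> s p = vtx v3 -> s q = vtx v4 -> exists m, moved a l s m.
Proof.
move=> pa qa sp sq; have occ : occupied [ffun u => if u == a then l else s u].
  apply/andP; split; apply/existsP; [exists p | exists q].
    by rewrite ffunE (negPf pa) sp.
  by rewrite ffunE (negPf qa) sq.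
by exists (Cell occ); rewrite /moved.
Qed.

Definition edge4_loc D (a u : 'I_n) : loc :=
  if u \in D then edge v4 else if u == a then vtx v3 else vtx v4.

Lemma cardC_setU1 D a : a \notin D -> #|~: (D :|: [set a])| = (n - #|D|).-1.
Proof.
move=> aD; have := cardsC (a |: D); rewrite cardsU1 aD card_ord setUC; lia.
Qed.

Lemma edge4_cell_exists D a : a \notin D -> (#|D|.+1 < n)%N ->
  exists t, t =1 edge4_loc D a.
Proof.
move=> aD Dn; have /card_gt0P[b] : (0 < #|~: (D :|: [set a])|)%N.
  by rewrite cardC_setU1 //; lia.
rewrite !inE negb_or => /andP[bD ba].
have occ : occupied [ffun u => edge4_loc D a u].
  apply/andP; split; apply/existsP; [exists a | exists b]; rewrite ffunE /edge4_loc.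
    by rewrite (negPf aD) eqxx.
  by rewrite (negPf bD) (negPf ba).
by exists (Cell occ) => u; rewrite /= ffunE.
Qed.

Section Edge4Cell.
Variables (D : {set 'I_n}) (a : 'I_n) (t : cell n).
Hypotheses (aD : a \notin D) (tE : t =1 edge4_loc D a).

Lemma edge4_entries :
  entries t = (set0, set0, set0, set0, [set a], set0, ~: (D :|: [set a]), D).
Proof.
rewrite /entries; congr (_, _, _, _, _, _, _, _); apply/setP=> u;
  rewrite !inE tE /edge4_loc; case: ifPn => uD //=; case: (eqVneq u a) => //= ua.
by rewrite ua (negPf aD) in uD.
Qed.

Lemma edge4_ysets : ysets t = D.
Proof.
by apply/setP=> u; rewrite !inE tE /edge4_loc; case: ifP => //; case: ifP.
Qed.

(** As a lower member, [t] would need a second label at vertex 3 or a label above [a] at vertex 4.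
    As an upper member, it would need a label on another edge. *)
Lemma edge4_critical : is_max (~: D) a -> critical t.
Proof.
case/andP=> _ /forall_inP am; move: edge4_entries => [x1 y1 x2 y2 x3 y3 x4 y4].
apply/forallP=> m; apply/andP; split; apply/negP.
  rewrite /Wpair x1 y1 x2 y2 x3 y3 !setU0 !set0U eqxx /=.
  case/existsP=> a' /andP[/andP[]]; rewrite inE => /eqP-> _.
  rewrite cards1 ltnn andbF /= eqxx => /existsP[b /and5P[_ bx _ ab _]].
  have: b \in ~: D by move: bx; rewrite x4 !inE negb_or => /andP[].
  by move/am; rewrite leqNgt ab.
case/Wpair_push=> u [i [_ [iv tu _]]]; have: u \in ysets t by rewrite inE tu.
rewrite edge4_ysets => uD; move: tu; rewrite tE /edge4_loc uD => -[] e.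
by rewrite -e eqxx in iv.
Qed.

End Edge4Cell.

(** A label at vertex 1 or 2, a second label at vertex 3, or a label above [a] at vertex 4 would
    make [t] a lower member. This leaves one cell for each D. *)
Lemma critical_edge4 D t : (#|D| < n - 2)%N ->
  ysets t = D -> yset v4 t = D -> critical t ->
  exists2 a, is_max (~: D) a & t =1 edge4_loc D a.
Proof.
move=> Dn YD Y4 /forallP tc.
have noW m : Wpair t m = false by apply/negbTE; case/andP: (tc m).
have tY u i : t u = edge i -> i = v4.
  move=> tu; have : u \in yset v4 t by rewrite Y4 -YD inE tu.
  by rewrite inE tu => /eqP[].
have y0 i : i != v4 -> yset i t = set0.
  by move=> iv; apply/setP=> u; rewrite !inE; apply: contra_neqF iv => /eqP/tY.
have [p tp] : exists p, t p = vtx v3.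
  by case: (t) => c /= /andP[/existsP[p /eqP]]; exists p.
have [q tq] : exists q, t q = vtx v4.
  by case: (t) => c /= /andP[_ /existsP[q /eqP]]; exists q.
have x1 : xset v1 t = set0.
  apply/eqP/negPn/negP => x1; have [a am] := is_min_exists x1.
  have [m mv] : exists m, moved a (edge v1) t m.
    case/andP: am; rewrite inE => /eqP ta _.
    by apply: (@moved_exists _ _ _ p q) => //; apply/eqP=> e; rewrite -e ?tp ?tq in ta.
  move: (noW m); rewrite /Wpair y0 // setU0 x1 => /existsP[].
  by exists a; rewrite am mv andbT; case/andP: am.
have x2 : xset v2 t = set0.
  apply/eqP/negPn/negP => x2; have [a am] := is_min_exists x2.
  have [m mv] : exists m, moved a (edge v2) t m.
    case/andP: am; rewrite inE => /eqP ta _.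
    by apply: (@moved_exists _ _ _ p q) => //; apply/eqP=> e; rewrite -e ?tp ?tq in ta.
  move: (noW m); rewrite /Wpair x1 !y0 // !setU0 eqxx /= x2 => /existsP[].
  by exists a; rewrite am mv andbT; case/andP: am.
have [a am] : exists a, is_min (xset v3 t) a.
  by apply: is_min_exists; apply/set0Pn; exists p; rewrite inE tp.
have ax : a \in xset v3 t by case/andP: am.
have ta : t a = vtx v3 by move: ax; rewrite inE => /eqP.
have x3 : xset v3 t = [set a].
  apply/eqP/negPn/negP => x3.
  have [r] : exists r, r \in xset v3 t :\ a.
    by apply/set0Pn; rewrite setD_eq0 subset1 negb_or x3; apply/set0Pn; exists a.
  rewrite !inE => /andP[ra /eqP tr].
  (* The second label [r] keeps vertex 3 occupied when [a] leaves, so rule (3a) applies. *)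
  have [m mv] : exists m, moved a (edge v3) t m.
    by apply: (@moved_exists _ _ _ r q) => //; apply/eqP=> e; rewrite -e tq in ta.
  move: (noW m); rewrite /Wpair x1 x2 !y0 // !setU0 eqxx /= => /existsP[].
  exists a; rewrite am ax mv andbT /=; apply/orP; left.
  by rewrite (cardsD1 a) ax (cardsD1 r) !inE ra tr.
have aD : a \notin D by rewrite -YD inE ta.
have tE : t =1 edge4_loc D a.
  move=> u; rewrite /edge4_loc -YD inE; case: (locP (t u)) => -[] tu; rewrite ?tu //=;
    try by have := tY _ _ tu.
  - by move/setP/(_ u): x1; rewrite !inE tu.
  - by move/setP/(_ u): x2; rewrite !inE tu.
  - by move/setP/(_ u): x3; rewrite !inE tu eqxx => <-.
  - by case: eqVneq tu => // ->; rewrite ta.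
exists a => //; apply/andP; rewrite inE; split=> //; apply/forall_inP=> u uD.
have [_ _ _ _ _ _ x4 _] := edge4_entries aD tE.
have [b bm] : exists b, is_max (xset v4 t) b.
  by apply: is_max_exists; apply/set0Pn; exists q; rewrite inE tq.
have [bx /forall_inP bmax] := andP bm.
(* The bound on [#|D|] leaves two labels at vertex 4, as rule (3b) requires. *)
have x4c : (2 <= #|xset v4 t|)%N.
  by rewrite x4 cardC_setU1 //; lia.
have ba : (b <= a)%N.
  rewrite leqNgt; apply/negP => ab.
  have [r] : exists r, r \in xset v4 t :\ b.
    by apply/card_gt0P; move: x4c; rewrite (cardsD1 b) bx.
  rewrite !inE => /andP[rb /eqP tr].
  have [m mv] : exists m, moved b (edge v3) t m.
    by apply: (@moved_exists _ _ _ a r) => //; rewrite neq_ltn ab.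
  move: (noW m); rewrite /Wpair x1 x2 !y0 // !setU0 eqxx /= => /existsP[].
  exists a; rewrite am x3 eqxx /=; apply/orP; right.
  by apply/existsP; exists b; rewrite set0U bm bx x4c ab mv.
have [->//|ua] := eqVneq u a.
apply: leq_trans ba; apply: bmax; rewrite x4 !inE negb_or ua andbT.
by move: uD; rewrite inE.
Qed.

(** * The cocycles f_D and their products *)

(** For [D = [set u]] this is the pullback, along the coordinate of [u], of the cocycle on the
    circle dual to the edge from 4 to 1. *)
Definition edge4_cochain D : cochain n :=
  [ffun t => ((ysets t == D) && (yset v4 t == D))%:R].

Lemma yset4_push b A t : yset v4 (push b A t) = yset v4 t :\: A.
Proof.
by apply/setP=> u; rewrite !inE pushE; case: (u \in A) => //=; case: (t u).
Qed.

Lemma edge4_cocycle D : delta (edge4_cochain D) = 0.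
Proof.
apply/ffunP=> s; rewrite !ffunE big1 // => u _.
by rewrite !ffunE !ysets_push !yset4_push F2_addxx.
Qed.

(** In the term of [S] the left factor sees a face with edge labels S and the right factor one with
    the remaining edge labels. So only [S = D] can contribute, and then A is the rest. *)
Lemma edge4_cup D A : [disjoint D & A] ->
  cup (edge4_cochain D) (edge4_cochain A) = edge4_cochain (D :|: A).
Proof.
move=> DA; apply/ffunP=> s; rewrite !ffunE.
have AD : (D :|: A) :\: D = A.
  by rewrite setDUl setDv set0U; apply/setDidPl; rewrite disjoint_sym.
have DdA : (D :|: A) :\: A = D by rewrite setDUl setDv setU0; apply/setDidPl.
have yY : yset v4 s \subset ysets s by apply/subsetP=> u; rewrite !inE => /eqP->.
have E (S : {set 'I_n}) : S \subset ysets s ->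
    edge4_cochain D (push false (ysets s :\: S) s) * edge4_cochain A (push true S s) =
    ((S == D) && ((ysets s == D :|: A) && (yset v4 s == D :|: A)))%:R.
  move=> sS; rewrite !ffunE !ysets_push !yset4_push setDDr setDv set0U (setIidPr sS).
  rewrite -natrM mulnb; congr (nat_of_bool _)%:R; apply/idP/idP.
    case/andP=> /andP[/eqP SD /eqP y1] /andP[/eqP y2 /eqP y3]; subst S.
    have YE : ysets s = D :|: A by rewrite -y2 setDE setUIr setUCr setIT; apply/esym/setUidPr.
    have Dy : D \subset yset v4 s by rewrite -y1 subsetDl.
    have Ay : A \subset yset v4 s by rewrite -y3 subsetDl.
    by rewrite YE !eqxx eqEsubset subUset Dy Ay -YE yY.
  case/andP=> /eqP-> /andP[/eqP-> /eqP->].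
  by rewrite AD DdA !eqxx.
rewrite (eq_bigr _ E); case: (boolP (_ && _)) => [/andP[/eqP YE _]|_]; last first.
  by rewrite big1 // => S _; rewrite andbF.
rewrite (bigD1 D) ?YE ?subsetUl //= eqxx big1 ?addr0 // => S /andP[_ /negPf->] //.
Qed.

Lemma dual_cochain_edge4 D t : (#|D| < n - 2)%N ->
  ysets t = D -> yset v4 t = D -> critical t -> dual_cochain t = edge4_cochain D.
Proof.
move=> Dn YD Y4 tc; apply: dual_cochain_unique => //; first exact: edge4_cocycle.
  (* An upper member has a label on an edge other than that from 4 to 1. *)
  move=> r m /Wpair_push[u [i [_ [iv mu _]]]]; rewrite ffunE.
  case: andP => // -[/eqP Ym /eqP Y4m].
  have : u \in yset v4 m by rewrite Y4m -Ym inE mu.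
  by rewrite inE mu => /eqP[] e; rewrite e eqxx in iv.
move=> m mc; rewrite ffunE; congr (nat_of_bool _)%:R.
apply/andP/eqP => [[/eqP Ym /eqP Y4m]|->]; last by rewrite YD Y4.
have [a am tE] := critical_edge4 Dn YD Y4 tc.
have [b bm mE] := critical_edge4 Dn Ym Y4m mc.
by apply: cell_eqP => u; rewrite tE mE (is_max_inj am bm).
Qed.

(** * Passage to cohomology classes *)

Lemma coh_class_val (f : cochain n) (fZ : f \in @is_cocycle n) :
  coh_class f = \pi_(cohomology n)%qT (Cocycle fZ).
Proof. by congr (\pi_(cohomology n)%qT _); apply: val_inj; rewrite val_insubd fZ. Qed.

(** Since [coh_class] sends a cochain that is not a cocycle to 0, the factors are taken to be
    cocycles; their product is then one as well. *)
Lemma coh_classM (f g : cochain n) : f \in @is_cocycle n -> g \in @is_cocycle n ->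
  coh_class (f * g) = coh_class f * coh_class g.
Proof.
move=> fZ gZ; have fgZ : f * g \in @is_cocycle n by apply: rpredM.
rewrite !coh_class_val -[RHS]coh_piM.
by congr (\pi_(cohomology n)%qT _); apply: val_inj.
Qed.

Lemma coh_class1 : coh_class (1 : cochain n) = 1.
Proof.
rewrite (coh_class_val (rpred1 _)).
by congr (\pi_(cohomology n)%qT _); apply: val_inj.
Qed.

Lemma coh_class_prod (I : Type) (r : seq I) (F : I -> cochain n) :
  (forall i, F i \in @is_cocycle n) ->
  coh_class (\prod_(i <- r) F i) = \prod_(i <- r) coh_class (F i).
Proof.
move=> FZ; elim: r => [|i r IH]; first by rewrite !big_nil coh_class1.
by rewrite !big_cons coh_classM ?IH // rpred_prod.
Qed.

Lemma prod_edge4 (r : seq 'I_n) : uniq r ->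
  \prod_(u <- r) edge4_cochain [set u] = edge4_cochain [set u in r].
Proof.
elim: r => [_|u r IH /= /andP[ur /IH {}IH]].
  (* The unit cochain is f_D for empty D: without edge labels [yset v4 t] is empty too. *)
  rewrite big_nil; apply/ffunP=> t; rewrite !ffunE.
  have -> : [set u in [::]] = set0 :> {set 'I_n} by apply/setP=> u; rewrite !inE.
  case: eqP => //= Y0; rewrite -subset0 -Y0.
  by have -> : yset v4 t \subset ysets t by apply/subsetP=> u; rewrite !inE => /eqP->.
rewrite big_cons IH [LHS]edge4_cup; last by rewrite disjoints1 inE.
by congr edge4_cochain; apply/setP=> x; rewrite !inE.
Qed.

End Matching.

Theorem theorem4p3 (n j : nat) (hn : (4 <= n)%N) (hj1 : (1 <= j)%N)
    (hj2 : (j < n - 2)%N)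
    (sigma : 'I_j -> cell n) (v w : 'I_j -> 'I_n) (Z : 'I_j -> {set 'I_n})
    (sigma_inj : injective sigma)
    (sigma_crit : forall i, critical (sigma i))
    (sigma_dim : forall i, cell_dim (sigma i) = 1%N)
    (sigma_entries : forall i, entries (sigma i) =
       (set0, set0, set0, set0, [set v i], set0, Z i, [set w i])) :
  let D := [set w i | i : 'I_j] in
  (forall i, dual_cochain (sigma i) \in @is_cocycle n) /\
  exists (a : 'I_n) (tau : cell n),
    [/\ is_max (~: D) a,
        entries tau =
          (set0, set0, set0, set0, [set a], set0, ~: (D :|: [set a]), D),
        critical tau /\ cell_dim tau = j,
        dual_cochain tau \in @is_cocycle n &
        \prod_(i < j) dual_class (sigma i) = dual_class tau].
Proof.
move=> D.
have w1 i : (#|[set w i]| < n - 2)%N by rewrite cards1; case: (n) hn => [|[|[|[]]]].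
have Y4 i : yset v4 (sigma i) = [set w i] by case: (sigma_entries i).
have Y i : ysets (sigma i) = [set w i].
  (* The cell has dimension 1 and [w i] is on an edge, so there is no other edge label. *)
  apply/esym/eqP; rewrite eqEcard cards1 [X in (X <= _)%N]sigma_dim leqnn andbT.
  by rewrite -Y4; apply/subsetP=> u; rewrite !inE => /eqP->.
have dualE i : dual_cochain (sigma i) = edge4_cochain [set w i].
  exact: dual_cochain_edge4.
have edgeZ A : edge4_cochain A \in @is_cocycle n by rewrite inE edge4_cocycle.
split=> [i|]; first by rewrite dualE.
(* A critical 1-cell of this form is determined by its edge label, so distinct cells have distinct
   [w i]. Hence D has j elements and the singletons are disjoint. *)
have w_inj : injective w.
  move=> i k wik; apply: sigma_inj.
  have [a am iE] := critical_edge4 (w1 i) (Y i) (Y4 i) (sigma_crit i).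
  have [b bm kE] := critical_edge4 (w1 k) (Y k) (Y4 k) (sigma_crit k).
  by apply: cell_eqP => u; rewrite iE kE wik; rewrite wik in am; rewrite (is_max_inj am bm).
have cD : #|D| = j by rewrite card_imset // card_ord.
have [a am] : exists a, is_max (~: D) a.
  apply: is_max_exists; rewrite -card_gt0.
  by rewrite cardsCs setCK cD card_ord; lia.
have aD : a \notin D by case/andP: am; rewrite inE.
have [tau tauE] : exists tau : cell n, tau =1 edge4_loc D a.
  by apply: (edge4_cell_exists aD); rewrite cD; lia.
have tc := edge4_critical aD tauE am.
have tauD : dual_cochain tau = edge4_cochain D.
  apply: dual_cochain_edge4 => //; rewrite ?cD //; first exact: edge4_ysets tauE.
  by case: (edge4_entries aD tauE).
exists a, tau; split=> //; first exact: edge4_entries.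
- by split=> //; rewrite /cell_dim (edge4_ysets tauE).
- by rewrite tauD.
(* The identity already holds between the representing cochains. *)
rewrite /dual_class tauD -coh_class_prod => [|i]; last by rewrite dualE.
congr coh_class; under eq_bigr do rewrite dualE.
rewrite -(big_map w xpredT (fun u => edge4_cochain [set u])) prod_edge4.
  congr edge4_cochain; apply/setP=> u; rewrite inE.
  by apply/mapP/imsetP => -[i _ ->]; exists i; rewrite ?mem_index_enum.
by rewrite map_inj_uniq // index_enum_uniq.
Qed.
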